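(* Consider a Dynamic Generative System with Symmetry (DGSS) whose distinguished object is denoted $\overline{n}$, and let $1$ be a fixed object with $1 \neq \overline{n}$. Then the triple consisting of the relational set $N = (\overline{n}\,x)$, the successor operation $x \mapsto (1\,x)$ and the object $1$ is a model of natural numbers, i.e. the following relational forms of Peano's axioms hold, where the variables $x, y, k$ range over objects different from $\overline{n}$: (1) $(\overline{n}\,1) = 1$, i.e. $1$ is an element of $N$. (2) For all $x$: if $(\overline{n}\,x) = x$ then $(\overline{n}\,(1\,x)) = (1\,x)$. (3) For all $x, y$: if $(\overline{n}\,x) = x$, $(\overline{n}\,y) = y$ and $(1\,x) = (1\,y)$, then $x = y$. (4) For all $x$: if $(\overline{n}\,x) = x$ then $(1\,x) \neq 1$. (5) For every relational set $M = (\overline{m}\,x)$ (with $\overline{m}$ an object): if $M$ is a relational subset of $N$, $1$ is an element of $M$, and for all $k$, $k$ being an element of $M$ implies that $(1\,k)$ is an element of $M$, then $M = N$.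
   Context: Relational Calculus: there is a collection of objects with a binary application operation; the application of $a$ to $b$ is written $(a\,b)$ and is again an object. Application is associative: for all objects $a,b,c$, $(a\,b\,c) = ((a\,b)\,c) = (a\,(b\,c))$. The symbol $=$ between objects is the logical equality sign, with the classical deduction rules (reflexivity, symmetry, transitivity). A Dynamic Generative System with Symmetry (DGSS) with distinguished object $\overline{n}$ is such a system satisfying: (i) for all $y$, $(\overline{n}\,y) = y$; (ii) for all $y$ there exists $z$ with $(z\,y) = \overline{n}$; (iii) for all $y$ there exists $z$ with $(z\,y) = (y\,z) = \overline{n}$. Relational sets: an object $\overline{q}$ (a ''quality'') determines the relational set $Q = (\overline{q}\,x)$; an object $x$ is an element of $Q$ iff $(\overline{q}\,x) = x$. A relational set $B = (\overline{b}\,x)$ is a relational subset of $A = (\overline{a}\,x)$ iff for all $x$, $(\overline{b}\,x) = x$ implies $(\overline{a}\,x) = x$. Equality $M = N$ of the relational sets $M = (\overline{m}\,x)$ and $N = (\overline{n}\,x)$ means $(\overline{m}\,k) = (\overline{n}\,k)$ for all $k$. The object $\overline{n}$ plays the role of the quality of being a natural number and is itself explicitly excluded from being a number ($x \neq \overline{n}$ for the numbers $x$ considered). The object $(1\,x)$ is called the successor of $x$. *)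

(* Defs.v *)
Set Implicit Arguments.
Unset Strict Implicit.
Unset Printing Implicit Defensive.

(* Equality of objects is Leibniz equality; no decidability is assumed. *)
Record relational_calculus : Type := RelationalCalculus {
  object :> Type;
  app : object -> object -> object;
  app_assoc : forall a b c : object, app (app a b) c = app a (app b c)
}.

Declare Scope relcalc_scope.
Delimit Scope relcalc_scope with RC.
Notation "a · b" := (app a b) (at level 40, left associativity) : relcalc_scope.
Local Open Scope relcalc_scope.

Record DGSS (C : relational_calculus) (n : C) : Prop := {
  DGSS_id : forall y : C, n · y = y;
  DGSS_gen : forall y : C, exists z : C, z · y = n;
  DGSS_sym : forall y : C, exists z : C, z · y = n /\ y · z = n
}.

(* The relational set (q x) is presented by its quality q.  The intended
   equality of relational sets is [releq] below, not Leibniz equality. *)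
Record relset (C : relational_calculus) : Type := RelSet { quality : C }.

Definition relelem (C : relational_calculus) (x : C) (Q : relset C) : Prop :=
  quality Q · x = x.

Definition relsubset (C : relational_calculus) (B A : relset C) : Prop :=
  forall x : C, relelem x B -> relelem x A.

Definition releq (C : relational_calculus) (M N : relset C) : Prop :=
  forall k : C, quality M · k = quality N · k.

Definition successor (C : relational_calculus) (one x : C) : C := one · x.

(* Main.v *)
Require Import Defs.
Local Open Scope relcalc_scope.

(** A dynamic generative system with symmetry is a group: [n] is a left
    identity, and every object has a two-sided inverse relative to [n].
    Everything therefore reduces to cancellation.  Since [n · y = y] for all
    [y], every object is an element of [N], which gives the first two axioms.
    Injectivity of the successor is left cancellation of [one]; and
    [one · x = one] would force [x] to be the identity, which is not a number.

    Induction holds because a set [M] containing even a single object has a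
    quality that fixes that object, and in a group an element with a fixed
    point under left multiplication acts as the identity.  So [one] being an
    element of [M] already forces [M = N]. *)

Lemma app_cancel_l {C : relational_calculus} {n : C} (hn : DGSS n)
    {a x y : C} : a · x = a · y -> x = y.
Proof.
  intros E.
  destruct (DGSS_gen hn a) as [z Hz].
  rewrite <- (DGSS_id hn x), <- (DGSS_id hn y), <- Hz, !app_assoc, E.
  reflexivity.
Qed.

(** Multiplying [a · x = a] on the left by an inverse of [a] turns [a] into
    [n], on both sides at once. *)
Lemma right_unit_eq {C : relational_calculus} {n : C} (hn : DGSS n)
    {a x : C} : a · x = a -> x = n.
Proof.
  intros E.
  destruct (DGSS_gen hn a) as [z Hz].
  rewrite <- (DGSS_id hn x), <- Hz, app_assoc, E.
  reflexivity.
Qed.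

(** Since [k = n · k = a · (z · k)] for a right inverse [z] of [a], what fixes
    [a] on the left fixes every [k]. *)
Lemma fix_one_fix_all {C : relational_calculus} {n : C} (hn : DGSS n)
    {m a : C} : m · a = a -> forall k : C, m · k = k.
Proof.
  intros E k.
  destruct (DGSS_sym hn a) as [z [_ Hz]].
  rewrite <- (DGSS_id hn k), <- Hz, <- !app_assoc, E.
  reflexivity.
Qed.

Theorem proposition4p1 (C : relational_calculus) (n : C) (hn : DGSS n)
    (one : C) (one_neq_n : one <> n) :
  let N := RelSet n in
  let S := successor one in
  relelem one N
  /\ (forall x : C, x <> n -> relelem x N -> relelem (S x) N)
  /\ (forall x y : C, x <> n -> y <> n ->
        relelem x N -> relelem y N -> S x = S y -> x = y)
  /\ (forall x : C, x <> n -> relelem x N -> S x <> one)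
  /\ (forall M : relset C,
        relsubset M N ->
        relelem one M ->
        (forall k : C, k <> n -> relelem k M -> relelem (S k) M) ->
        releq M N).
Proof.
  intros N S. unfold N, S, relelem, releq, successor; simpl.
  repeat split.
  - apply (DGSS_id hn).
  - intros x _ _. apply (DGSS_id hn).
  - intros x y _ _ _ _. apply (app_cancel_l hn).
  - intros x Hx _ E. exact (Hx (right_unit_eq hn E)).
  - intros M _ H1 _ k.
    rewrite (DGSS_id hn k). exact (fix_one_fix_all hn H1 k).
Qed.
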